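(* Let $X$ be a finite set and $F$ the free group on $X$. Let $\Gamma$ be a finite $X$-labelled graph that is an immersion, let $\Gamma^+$ be any covering expansion of $\Gamma$, and let $G$ be the group of deck transformations of $\Gamma^+$ (in the sense defined in the context). Let $H$ be a finite group generated by $X$, and let $\phi:H\to G$ be a group homomorphism such that $[w]_G=\phi([w]_H)$ for each $w\in F$. Let $\eta$ and $\eta'$ be reduced paths in the Cayley graph $\mathcal{C}(H)$ such that $\alpha(\eta)=\alpha(\eta')$, and suppose that each geometric edge traversed by $\eta$ is also traversed by $\eta'$. Then for any reduced path $\gamma'$ in $\Gamma$ such that $\ell(\gamma')=\ell(\eta')$, there is a path $\gamma$ in $\Gamma$ such that $\ell(\gamma)=\ell(\eta)$ and $\alpha(\gamma)=\alpha(\gamma')$; if in addition $\omega(\eta)=\omega(\eta')$, then $\omega(\gamma)=\omega(\gamma')$.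
   Context: Graphs are in the sense of Serre: each edge $e$ has an initial vertex $\alpha(e)$, a terminal vertex $\omega(e)$, and a reverse edge $\bar e\neq e$ with $\bar{\bar e}=e$, $\alpha(\bar e)=\omega(e)$, $\omega(\bar e)=\alpha(e)$. A geometric edge is a pair $\{e,\bar e\}$; a path traverses it if $e$ or $\bar e$ occurs in the path. An $X$-labelled graph has a label $\ell(e)\in X\sqcup X^{-1}$ on each edge $e$, with $\ell(\bar e)=\ell(e)^{-1}$. For a path $\gamma$, $\alpha(\gamma)$, $\omega(\gamma)$ and $\ell(\gamma)$ denote its initial vertex, its terminal vertex and its label (the word formed by the labels of its edges in order). A path is reduced if it contains no consecutive edges $e,\bar e$. An $X$-labelled graph (not necessarily connected) is an immersion (resp. covering) if for each vertex $v$ and each $a\in X\sqcup X^{-1}$ there is at most one (resp. exactly one) edge with initial vertex $v$ and label $a$. A covering expansion of an immersion $\Gamma$ is a finite $X$-labelled graph $\Gamma^+$ that is a covering and contains $\Gamma$ as a labelled subgraph. A group generated by $X$ is a group $K$ together with a fixed surjective homomorphism $F\to K$; the image of $w\in F$ (or of a word $w$ in $X\sqcup X^{-1}$) is denoted $[w]_K$. The Cayley graph $\mathcal{C}(K)$ is the $X$-labelled graph with vertex set $K$ and, for each $g\in K$ and $x\in X$, an edge labelled $x$ from $g$ to $g[x]_K$ (together with its reverse, labelled $x^{-1}$). Group of deck transformations: if $\Delta$ is a finite covering with vertex set $V$, then $F$ acts on $V$ on the right, where $u\cdot w$ is the terminal vertex of the unique path in $\Delta$ starting at $u$ with label $w$.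 The ''group of deck transformations'' of $\Delta$ is the group of permutations of $V$ induced by this action (composed as right actions), i.e. the quotient of $F$ by the kernel of the action, regarded as a group generated by $X$ through this quotient map. *)

(* Defs.v *)
From HB Require Import structures.
From mathcomp Require Import all_boot all_fingroup.
From mathcomp Require Import boolp.

Set Implicit Arguments.
Unset Strict Implicit.
Unset Printing Implicit Defensive.

Local Open Scope group_scope.

(* The alphabet X \sqcup X^-1: (x, false) stands for x, (x, true) for x^-1.   *)
Notation letter X := (X * bool)%type.

Definition linv (X : finType) (a : letter X) : letter X := (a.1, ~~ a.2).

Lemma linvK (X : finType) : involutive (@linv X).
Proof. by case=> x b; rewrite /linv /= negbK. Qed.

Section FreeGroup.
Variable X : finType.
Implicit Types (a b : letter X) (u v w t : seq (letter X)).

Definition freely_reduced w : bool := sorted [rel a b | b != linv a] w.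

(* Left multiplication of a freely reduced word by a letter. *)
Definition push a w : seq (letter X) :=
  if w is b :: w' then if b == linv a then w' else a :: w else [:: a].

Definition reduce w : seq (letter X) := foldr push [::] w.

Lemma push_reduced a w : freely_reduced w -> freely_reduced (push a w).
Proof.
case: w => [|b w] //= Hw; case: ifPn => Hb; last by rewrite /= Hb.
exact: path_sorted Hw.
Qed.

Lemma foldr_push_reduced t w :
  freely_reduced t -> freely_reduced (foldr push t w).
Proof. by move=> Ht; elim: w => //= a w IH; apply: push_reduced. Qed.

Lemma reduce_reduced w : freely_reduced (reduce w).
Proof. exact: foldr_push_reduced. Qed.

Lemma pushVK a w : freely_reduced w -> push a (push (linv a) w) = w.
Proof.
case: w => [|b w] /=; first by rewrite eqxx.
rewrite linvK; case: eqP => [-> | _] /=; last by rewrite eqxx.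
by case: w => [|c w] //= /andP[/negbTE-> _].
Qed.

Lemma pushKV a w : freely_reduced w -> push (linv a) (push a w) = w.
Proof. by move=> Hw; rewrite -{2}(linvK a) pushVK. Qed.

Lemma foldr_push_reduce t w :
  freely_reduced t -> foldr push t (reduce w) = foldr push t w.
Proof.
move=> Ht; elim: w => //= a w <-; case: (reduce w) => //= b s.
case: eqP => //= ->; rewrite pushVK //; exact: foldr_push_reduced.
Qed.

Lemma reduce_id w : freely_reduced w -> reduce w = w.
Proof.
elim: w => //= a w IH Hw; rewrite IH; last exact: path_sorted Hw.
by case: w Hw {IH} => //= b w /andP[/negbTE->].
Qed.

Lemma reduce_cat u v : reduce (u ++ v) = foldr push (reduce v) u.
Proof. by rewrite /reduce foldr_cat. Qed.

Record freeGroup := FreeGroup {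
  fval :> seq (letter X);
  fvalP : freely_reduced fval
}.

HB.instance Definition _ := [isSub for fval].
HB.instance Definition _ := [Choice of freeGroup by <:].

Definition winv w : seq (letter X) := rev (map (@linv X) w).

Lemma winv_reduced w : freely_reduced w -> freely_reduced (winv w).
Proof.
rewrite /winv /freely_reduced rev_sorted sorted_map.
by apply: sub_sorted => a b /=; rewrite linvK eq_sym.
Qed.

Lemma winvK : involutive winv.
Proof.
move=> w; rewrite /winv map_rev revK -map_comp -[RHS]map_id.
by apply: eq_map => a /=; rewrite linvK.
Qed.

Lemma foldr_winv t w :
  freely_reduced t -> foldr push (foldr push t w) (winv w) = t.
Proof.
move=> Ht; elim: w => //= a w IH.
rewrite /winv /= rev_cons -cats1 foldr_cat /= pushKV //.
exact: foldr_push_reduced.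
Qed.

(* The element of the free group represented by an arbitrary word. *)
Definition fword w : freeGroup := FreeGroup (reduce_reduced w).

Definition fmul (p q : freeGroup) : freeGroup := fword (p ++ q).
Definition finv (p : freeGroup) : freeGroup :=
  FreeGroup (winv_reduced (fvalP p)).

Lemma fmulA : associative fmul.
Proof.
move=> p q r; apply: val_inj => /=.
rewrite [LHS]reduce_cat (reduce_id (reduce_reduced _)) [RHS]reduce_cat.
rewrite (foldr_push_reduce _ (reduce_reduced _)) foldr_cat.
by rewrite -(reduce_cat q r).
Qed.

Lemma fmul1 : left_id (fword [::]) fmul.
Proof. by move=> p; apply: val_inj; rewrite /= reduce_id // fvalP. Qed.

Lemma fmul1r : right_id (fword [::]) fmul.
Proof. by move=> p; apply: val_inj; rewrite /= cats0 reduce_id // fvalP. Qed.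

Lemma fmulV : left_inverse (fword [::]) finv fmul.
Proof.
move=> p; apply: val_inj; rewrite /= reduce_cat.
exact: (@foldr_winv [::]).
Qed.

Lemma fmulVr : right_inverse (fword [::]) finv fmul.
Proof.
move=> p; apply: val_inj; rewrite /= reduce_cat.
by have := @foldr_winv [::] (winv p) isT; rewrite winvK.
Qed.

HB.instance Definition _ := isGroup.Build freeGroup
  fmulA fmul1 fmul1r fmulV fmulVr.

End FreeGroup.

(* Between groups, a UMagmaMorphism is a group homomorphism. *)
Record generated_by (X : finType) (K : groupType) := GeneratedBy {
  gproj : UMagmaMorphism.type (freeGroup X) K;
  gproj_surj : forall k : K, exists w, gproj w = k
}.

Section Graphs.
Variables (X : finType).

Record lgraph (V E : eqType) := LGraph {
  src : E -> V;
  tgt : E -> V;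
  rev_edge : E -> E;
  label : E -> letter X;
  rev_edge_neq : forall e, rev_edge e != e;
  rev_edgeK : involutive rev_edge;
  src_rev : forall e, src (rev_edge e) = tgt e;
  tgt_rev : forall e, tgt (rev_edge e) = src e;
  label_rev : forall e, label (rev_edge e) = linv (label e)
}.

Section Paths.
Variables (V E : eqType) (D : lgraph V E).

Fixpoint walk (v : V) (s : seq E) : bool :=
  if s is e :: s' then (src D e == v) && walk (tgt D e) s' else true.

(* The initial vertex is stored so that there is a trivial path at each vertex. *)
Record gpath := GPath {
  pstart : V;
  pedges : seq E;
  pwalk : walk pstart pedges
}.

Definition pend (p : gpath) : V := last (pstart p) (map (tgt D) (pedges p)).

Definition plabel (p : gpath) : seq (letter X) := map (label D) (pedges p).

Definition reduced_path (p : gpath) : bool :=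
  sorted [rel e f | f != rev_edge D e] (pedges p).

Definition traverses (p : gpath) (e : E) : bool :=
  (e \in pedges p) || (rev_edge D e \in pedges p).

Definition immersion : Prop := forall v a e f,
  src D e = v /\ label D e = a -> src D f = v /\ label D f = a -> e = f.

Definition covering : Prop := forall v a,
  exists! e, src D e = v /\ label D e = a.

Lemma covering_lift : covering -> forall u w,
  exists p : gpath, pstart p = u /\ plabel p = w.
Proof.
move=> cov u w; elim: w u => [|a w IH] u; first by exists (@GPath u [::] isT).
have [e [[eu ea] _]] := cov u a; have [[v s ps] /= [pv pw]] := IH (tgt D e).
have P : walk u (e :: s) by rewrite /= eu eqxx -pv.
by exists (GPath P); split=> //; rewrite /plabel /= ea -pw.
Qed.

Lemma covering_inj : covering -> forall p q : gpath,
  pstart p = pstart q -> plabel p = plabel q -> pedges p = pedges q.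
Proof.
move=> cov [u s ps] [v t pt] /= uv; subst v; rewrite /plabel /=.
elim: s t u ps pt => [|e s IH] [|f t] //= u /andP[/eqP eu ps] /andP[/eqP fu pt].
case=> ef st; have [g [_ gP]] := cov u (label D e).
have ge := gP e (conj eu erefl); have gf := gP f (conj fu (esym ef)).
by rewrite -gf ge in pt *; rewrite (IH t _ ps pt st).
Qed.

End Paths.

Definition labelled_subgraph (V E V' E' : eqType)
    (D : lgraph V E) (D' : lgraph V' E') : Prop :=
  exists (fv : V -> V') (fe : E -> E'),
    [/\ injective fv, injective fe & forall e,
      [/\ src D' (fe e) = fv (src D e), tgt D' (fe e) = fv (tgt D e),
          rev_edge D' (fe e) = fe (rev_edge D e)
        & label D' (fe e) = label D e]].

Record covering_expansion (V E : finType) (D : lgraph V E) :=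
  CoveringExpansion {
    ce_vertex : finType;
    ce_edge : finType;
    ce_graph :> lgraph ce_vertex ce_edge;
    ce_covering : covering ce_graph;
    ce_subgraph : labelled_subgraph D ce_graph
  }.

Section Cayley.
Variables (K : groupType) (pi : generated_by X K).

Definition gletter (a : letter X) : K := gproj pi (fword [:: a]).

Lemma gletterV a : gletter a * gletter (linv a) = 1.
Proof.
have aV : fword [:: a] * fword [:: linv a] = 1.
  by apply: val_inj; rewrite /= eqxx.
by rewrite /gletter -gmulfM aV gmulf1.
Qed.

Definition csrc (e : K * letter X) := e.1.
Definition ctgt (e : K * letter X) := e.1 * gletter e.2.
Definition crev (e : K * letter X) := (e.1 * gletter e.2, linv e.2).
Definition clabel (e : K * letter X) := e.2.

Lemma crev_neq e : crev e != e.
Proof.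
case: e => g [x b].
by rewrite /crev !xpair_eqE; case: b; rewrite !andbF.
Qed.

Lemma crevK : involutive crev.
Proof. by case=> g a; rewrite /crev /= -mulgA gletterV mulg1 linvK. Qed.

Lemma ctgt_rev e : ctgt (crev e) = csrc e.
Proof. by rewrite /ctgt /= -mulgA gletterV mulg1. Qed.

(* The pair (g, a) is the edge from g to g[a] labelled by the letter a. *)
Definition cayley : lgraph K (K * letter X)%type :=
  @LGraph K (K * letter X)%type csrc ctgt crev clabel
    crev_neq crevK (fun=> erefl) ctgt_rev (fun=> erefl).

End Cayley.

Section Deck.
Variables (V E : finType) (D : lgraph V E) (cov : covering D).
Implicit Types (u v : V) (w : seq (letter X)).

Definition path_lift u w : gpath D := sval (cid (covering_lift cov u w)).

Definition vact u w : V := pend (path_lift u w).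

Lemma vactP (p : gpath D) : vact (pstart p) (plabel p) = pend p.
Proof.
rewrite /vact /path_lift; case: cid => q /= [qu qw].
by rewrite /pend qu (covering_inj cov qu qw).
Qed.

Lemma vact_nil u : vact u [::] = u.
Proof. exact: (vactP (@GPath _ _ D u [::] isT)). Qed.

Lemma vact_cons u a w : vact u (a :: w) = vact (vact u [:: a]) w.
Proof.
have [e [[eu ea] _]] := cov u a.
have P1 : walk D u [:: e] by rewrite /= eu eqxx.
have := vactP (GPath P1); rewrite /plabel /pend /= ea => ->.
have [[v s ps] [/= pv pw]] := covering_lift cov (tgt D e) w; subst v.
have P2 : walk D u (e :: s) by rewrite /= eu eqxx.
have := vactP (GPath P2); rewrite /plabel /pend /= ea => e1.
by have := vactP (GPath ps); rewrite -pw /plabel /pend /= e1.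
Qed.

Lemma vact_cat u w w' : vact u (w ++ w') = vact (vact u w) w'.
Proof.
elim: w u => [|a w IH] u /=; first by rewrite vact_nil.
by rewrite vact_cons IH -vact_cons.
Qed.

Lemma vact_linv u a : vact u [:: a; linv a] = u.
Proof.
have [e [[eu ea] _]] := cov u a.
have P : walk D u [:: e; rev_edge D e] by rewrite /= eu src_rev !eqxx.
have := vactP (GPath P); rewrite /plabel /pend /= label_rev ea => ->.
by rewrite tgt_rev.
Qed.

Lemma vact_push u a w : vact u (push a w) = vact u (a :: w).
Proof.
case: w => [|b w] //=; case: eqP => // ->.
by rewrite -[a :: _]/([:: a; linv a] ++ w) vact_cat vact_linv.
Qed.

Lemma vact_reduce u w : vact u (reduce w) = vact u w.
Proof.
by elim: w u => //= a w IH u; rewrite vact_push vact_cons IH -vact_cons.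
Qed.

Lemma vact_fmul u (p q : freeGroup X) : vact u (p * q) = vact (vact u p) q.
Proof. by rewrite /= vact_reduce vact_cat. Qed.

Lemma vact_inj (p : freeGroup X) : injective (fun u => vact u p).
Proof.
apply: (@can_inj _ _ _ (fun u => vact u p^-1)) => u.
by rewrite -vact_fmul mulgV vact_nil.
Qed.

Definition vact_perm (p : freeGroup X) : {perm V} := perm (@vact_inj p).

(* In {perm V}, (s * t) u = t (s u), so that this is a homomorphism. *)
Lemma vact_permM : {morph vact_perm : p q / p * q}.
Proof. by move=> p q; apply/permP=> u; rewrite permM !permE vact_fmul. Qed.

Definition deck_set : {set {perm V}} :=
  [set s | `[< exists p : freeGroup X, s = vact_perm p >]].

Lemma vact_perm_deck p : vact_perm p \in deck_set.
Proof. by rewrite inE; apply/asboolP; exists p. Qed.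

Lemma deck_group_set : group_set deck_set.
Proof.
apply/group_setP; split=> [|s t].
  suff -> : 1 = vact_perm 1 by exact: vact_perm_deck.
  by apply/permP=> u; rewrite perm1 permE vact_nil.
rewrite !inE => /asboolP[p ->] /asboolP[q ->].
by apply/asboolP; exists (p * q); rewrite vact_permM.
Qed.

Definition deck_group : finGroupType := subg_of (Group deck_group_set).

Definition deck_proj (p : freeGroup X) : deck_group :=
  Subg (vact_perm_deck p : vact_perm p \in Group deck_group_set).

Lemma deck_projM : monoid_morphism deck_proj.
Proof.
split=> [|p q]; apply: subg_inj; last exact: vact_permM.
by apply/permP=> u; rewrite permE vact_nil perm1.
Qed.

HB.instance Definition _ := isUMagmaMorphism.Build _ _ deck_proj deck_projM.

Lemma deck_proj_surj (s : deck_group) : exists p, deck_proj p = s.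
Proof.
case: s => s ds; have := ds; rewrite inE => /asboolP[p sE].
by exists p; apply: subg_inj; rewrite /= sE.
Qed.

Definition deck_generated : generated_by X deck_group :=
  GeneratedBy deck_proj_surj.

End Deck.
End Graphs.

Arguments ce_covering {X V E D} c.

(* Main.v *)
(* Fix the embedding fv of the vertices of Gamma into Gamma^+.  Acting through
   phi on the start of gamma' sends the vertices of C(H) to those of Gamma^+:
   the vertex h goes to pt h := fv (alpha(gamma')) . phi(alpha(eta')^-1 h), and
   this extends to a morphism of labelled graphs.  Because the labels of gamma'
   and eta' agree, the image of eta' is gamma', so every edge traversed by eta',
   hence every edge traversed by eta, goes to an edge of Gamma.  The image of eta
   is therefore the required path, and its end depends only on that of eta. *)
Require Import Defs.
From mathcomp Require Import all_boot all_fingroup.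

Set Implicit Arguments.
Unset Strict Implicit.
Unset Printing Implicit Defensive.

Local Open Scope group_scope.

Definition maps_into (X : finType) (V E W : eqType) (D : lgraph X V E)
    (K : groupType) (fv : V -> W) (pt : K -> W) (g : K * letter X) : Prop :=
  exists e, fv (src D e) = pt g.1 /\ label D e = g.2.

(* [pt] behaves as a graph morphism, but only where the image of a Cayley edge
   lies in [D]; this is what makes a covering unnecessary in the lifting lemmas. *)
Definition edge_compatible (X : finType) (V E W : eqType) (D : lgraph X V E)
    (K : groupType) (pi : generated_by X K) (fv : V -> W) (pt : K -> W) : Prop :=
  forall h e, fv (src D e) = pt h ->
    fv (tgt D e) = pt (h * gletter pi (label D e)).

Lemma maps_into_rev (X : finType) (V E W : eqType) (D : lgraph X V E)
    (K : groupType) (pi : generated_by X K) (fv : V -> W) (pt : K -> W)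
    (g : K * letter X) :
  edge_compatible D pi fv pt ->
  maps_into D fv pt g -> maps_into D fv pt (rev_edge (cayley pi) g).
Proof.
case: g => h a ptE [e /= [eh ea]]; exists (rev_edge D e) => /=.
by rewrite src_rev label_rev (ptE _ _ eh) ea.
Qed.

Lemma walk_image_end (X : finType) (V E W : eqType) (D : lgraph X V E)
    (K : groupType) (pi : generated_by X K) (fv : V -> W) (pt : K -> W) :
  edge_compatible D pi fv pt ->
  forall s t h v, fv v = pt h -> walk (cayley pi) h s -> walk D v t ->
  map (label D) t = map (label (cayley pi)) s ->
  fv (last v (map (tgt D) t)) = pt (last h (map (tgt (cayley pi)) s)).
Proof.
move=> ptE; elim=> [|[g a] s IH] [|e t] //= h v vh.
move=> /andP[/eqP gh ws] /andP[/eqP ev wt] [ea st].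
apply: IH ws wt st; rewrite /ctgt /= -[in RHS]ea; apply: ptE.
by rewrite ev vh -gh.
Qed.

Lemma walk_maps_into (X : finType) (V E W : eqType) (D : lgraph X V E)
    (K : groupType) (pi : generated_by X K) (fv : V -> W) (pt : K -> W) :
  edge_compatible D pi fv pt ->
  forall s t h v, fv v = pt h -> walk (cayley pi) h s -> walk D v t ->
  map (label D) t = map (label (cayley pi)) s ->
  forall g, g \in s -> maps_into D fv pt g.
Proof.
move=> ptE; elim=> [|[g a] s IH] [|e t] //= h v vh.
move=> /andP[/eqP gh ws] /andP[/eqP ev wt] [ea st].
have eg : fv (src D e) = pt g by rewrite ev vh -gh.
move=> g'; rewrite inE => /predU1P[-> | g's]; first by exists e.
by apply: (IH _ _ _ _ ws wt st) g's; rewrite (ptE _ _ eg) ea.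
Qed.

Lemma walk_lift (X : finType) (V E W : eqType) (D : lgraph X V E)
    (K : groupType) (pi : generated_by X K) (fv : V -> W) (pt : K -> W) :
  injective fv -> edge_compatible D pi fv pt ->
  forall s h v, fv v = pt h -> walk (cayley pi) h s ->
  (forall g, g \in s -> maps_into D fv pt g) ->
  exists2 t, walk D v t & map (label D) t = map (label (cayley pi)) s.
Proof.
move=> fvI ptE; elim=> [|[g a] s IH] h v vh; first by exists [::].
case/andP=> /= /eqP gh ws sD.
have [e [eg ea]] := sD _ (mem_head _ _).
have tE : fv (tgt D e) = pt (ctgt pi (g, a)) by rewrite (ptE _ _ eg) ea.
have [|t wt tl] := IH _ _ tE ws.
  by move=> g' g's; apply: sD; rewrite inE g's orbT.
exists (e :: t); last by rewrite /= tl ea.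
rewrite /= wt andbT; apply/eqP/fvI.
by rewrite eg vh -gh.
Qed.

Lemma vact_edge (X V E : finType) (D : lgraph X V E) (cov : covering D) (e : E) :
  vact cov (src D e) [:: label D e] = tgt D e.
Proof.
have w : walk D (src D e) [:: e] by rewrite /= eqxx.
exact: (vactP cov (GPath w)).
Qed.

Theorem lemma2p1 (X V E : finType) (Gamma : lgraph X V E)
  (Gamma_imm : immersion Gamma) (Gammap : covering_expansion Gamma)
  (G := deck_group (ce_covering Gammap))
  (piG := deck_generated (ce_covering Gammap) : generated_by X G)
  (H : finGroupType) (piH : generated_by X H)
  (phi : UMagmaMorphism.type H G)
  (phiP : forall w : freeGroup X, gproj piG w = phi (gproj piH w))
  (eta eta' : gpath (cayley piH))
  (eta_red : reduced_path eta) (eta'_red : reduced_path eta')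
  (eta_start : pstart eta = pstart eta')
  (eta_sub : forall e, traverses eta e -> traverses eta' e)
  (gamma' : gpath Gamma) (gamma'_red : reduced_path gamma')
  (gamma'_label : plabel gamma' = plabel eta') :
  exists gamma : gpath Gamma,
    [/\ plabel gamma = plabel eta,
        pstart gamma = pstart gamma'
      & pend eta = pend eta' -> pend gamma = pend gamma'].
Proof.
have [fv [fe [fvI _ feP]]] := ce_subgraph Gammap.
pose pt (h : H) := sgval (phi ((pstart eta')^-1 * h)) (fv (pstart gamma')).
have ptE : edge_compatible Gamma piH fv pt.
  move=> h e eh; rewrite /pt mulgA gmulfM /gletter -phiP permM -/(pt h) -eh permE.
  by have [<- <- _ <-] := feP e; rewrite (vact_edge (ce_covering Gammap)).
have pt_start : fv (pstart gamma') = pt (pstart eta').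
  by rewrite /pt mulVg gmulf1 perm1.
have eta'_in := walk_maps_into ptE pt_start (pwalk eta') (pwalk gamma') gamma'_label.
have eta_in g : g \in pedges eta -> maps_into Gamma fv pt g.
  move=> g_eta; have /eta_sub/orP[/eta'_in // | /eta'_in] : traverses eta g.
    by rewrite /traverses g_eta.
  by move/(maps_into_rev ptE); rewrite rev_edgeK.
rewrite -eta_start in pt_start.
have [t wt tl] := walk_lift fvI ptE pt_start (pwalk eta) eta_in.
exists (GPath wt); split=> // end_eq; apply: fvI.
rewrite /pend (walk_image_end ptE pt_start (pwalk eta) wt tl).
rewrite -[last _ _]/(pend eta) end_eq; rewrite eta_start in pt_start.
by rewrite (walk_image_end ptE pt_start (pwalk eta') (pwalk gamma') gamma'_label).
Qed.
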